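(* For all $n\ge1$ the class function $g\mapsto n!\,|\omega_n|(g)$ on $S_n$ is the character of the induced representation $$\rho_n^{+}:=\mathrm{Ind}_{C_n}^{S_n}(\chi_{\mathrm{triv}}),$$ from the cyclic group $C_n$ generated by an $n$-cycle of $S_n$, carrying the trivial representation $\chi_{\mathrm{triv}}$. The representation $\rho_n^{+}$ is of degree $(n-1)!$ and for $n\ge3$ is reducible. The trivial representation of $S_n$ occurs in $\rho_n^{+}$ with multiplicity $1$, and the sign representation $\chi_{\mathrm{sgn}}$ occurs with multiplicity $1$ if $n$ is odd and multiplicity $0$ if $n$ is even.
   Context: Representations are over $\mathbb{C}$. A partition $\lambda\vdash n$ is written $[n^{m_n},\dots,2^{m_2},1^{m_1}]$, where $m_j=m_j(\lambda)$ is the number of parts equal to $j$. $C_\lambda\subset S_n$ is the conjugacy class of permutations of cycle type $\lambda$. For a function $f$ on $S_n$ and $Y\subseteq S_n$, $f(Y):=\sum_{g\in Y}f(g)$ (so for a class function $f(g)=f(C_\lambda)/|C_\lambda|$ when $g\in C_\lambda$); $|f|(g):=|f(g)|$. The $m$-th necklace polynomial is $M_m(X)=\frac1m\sum_{d\mid m}\mu(d)X^{m/d}$. The cycle polynomial of $\lambda\vdash n$ is $N_\lambda(X)=\prod_{j=1}^n\binom{M_j(X)}{m_j(\lambda)}$, where $\binom{t}{k}=\frac{t(t-1)\cdots(t-k+1)}{k!}$. For $n\ge 2$ every $N_\lambda(X)$ is divisible by $X-1$, and the $1$-splitting measure on $S_n$ is the class function with $\nu_{n,1}^{\ast}(C_\lambda)=\left.\frac{N_\lambda(X)}{X^{n-1}(X-1)}\right|_{X=1}$.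 The measures $\omega_n$ on $S_n$ ($n\ge1$) are the class functions defined recursively by $\omega_1(C_{[1]})=1$ and, for $n\ge2$: $\omega_n(C_\lambda)=\nu_{n,1}^{\ast}(C_\lambda)$ if $\lambda=[b^a]$ with $ab=n$ and $b>1$; $\omega_n(C_{[1^n]})=\nu_{n,1}^{\ast}(C_{[1^n]})-\omega_{n-1}(C_{[1^{n-1}]})$; and $\omega_n(C_\lambda)=0$ for all other $\lambda$. *)

(* Defs.v *)
From HB Require Import structures.
From mathcomp Require Import all_boot all_order all_algebra.
From mathcomp Require Import all_fingroup all_solvable all_field all_character.
From mathcomp Require Import reals complex.

Set Implicit Arguments.
Unset Strict Implicit.
Unset Printing Implicit Defensive.

Import Order.TTheory GRing.Theory Num.Theory.
Local Open Scope ring_scope.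

(* Partitions are non-increasing sequences of positive parts. *)

Definition cycle_type (n : nat) (g : 'S_n) : seq nat :=
  sort geq [seq #|(A : {set 'I_n})| | A <- enum (porbits g)].

Definition cycle_class (n : nat) (lam : seq nat) : {set 'S_n} :=
  [set g : 'S_n | cycle_type g == lam].

Definition moebius (d : nat) : rat :=
  if all (fun p => logn p d == 1%N) (primes d) then (-1) ^+ size (primes d)
  else 0.

Definition necklace (m : nat) : {poly rat} :=
  m%:R^-1 *: \sum_(d <- divisors m) moebius d *: 'X^(m %/ d).

Definition binomial_poly (t : {poly rat}) (k : nat) : {poly rat} :=
  (k`!%:R)^-1 *: \prod_(i < k) (t - i%:R).

Definition cycle_poly (n : nat) (lam : seq nat) : {poly rat} :=
  \prod_(1 <= j < n.+1) binomial_poly (necklace j) (count_mem j lam).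

(* [splitting n lam] and [omega_class n lam] are the total masses of the class
   of cycle type [lam], for [lam] a partition of [n].  Only [n >= 2] matters in
   [splitting]; the cycle polynomial is then divisible by ['X - 1] but not in
   general by ['X], so only the factor ['X - 1] is cancelled before evaluating
   the rational function N / (X^(n-1) (X - 1)) at 1. *)
Definition splitting (n : nat) (lam : seq nat) : rat :=
  (cycle_poly n lam %/ ('X - 1)).[1] / ('X^(n.-1) : {poly rat}).[1].

Definition is_rectangular (n : nat) (lam : seq nat) : bool :=
  has (fun b => (1 < b)%N && (lam == nseq (n %/ b) b)) (divisors n).

Fixpoint omega_class (n : nat) (lam : seq nat) : rat :=
  match n with
  | 0 => 0
  | 1 => if lam == [:: 1%N] then 1 else 0
  | n'.+1 =>
      if is_rectangular n lam then splitting n lam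
      else if lam == nseq n 1%N
      then splitting n lam - omega_class n' (nseq n' 1%N)
      else 0
  end.

Definition omega (n : nat) (g : 'S_n) : rat :=
  omega_class n (cycle_type g) / #|cycle_class n (cycle_type g)|%:R.

Definition repr_degree (F : fieldType) (gT : finGroupType) (G : {group gT})
  (d : nat) (rG : mx_representation F G d) : nat := d.

Section TrivialRepr.

Variables (F : fieldType) (gT : finGroupType) (G : {group gT}).

Fact triv_mx_repr : mx_repr G (fun _ : gT => 1%:M : 'M[F]_1).
Proof. by split=> // x y _ _; rewrite mul1mx. Qed.

Definition triv_repr : mx_representation F G 1 := MxRepresentation triv_mx_repr.

End TrivialRepr.

Section SignRepr.

Variables (F : fieldType) (n : nat).

Fact sgn_mx_repr :
  mx_repr [set: 'S_n] (fun s : 'S_n => ((-1) ^+ odd_perm s)%:M : 'M[F]_1).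
Proof.
split=> [|x y _ _]; first by rewrite odd_perm1 expr0.
by rewrite odd_permM signr_addb scalar_mxM.
Qed.

Definition sgn_repr : mx_representation F [set: 'S_n]%G 1 :=
  MxRepresentation sgn_mx_repr.

End SignRepr.

(* The representation of [G] induced from [rH], in block form.  As
   [mx_representation]s act on row vectors from the right, it is indexed by the
   right cosets H t_i : if t_i x = h t_j then x maps the i-th copy of the
   space of [rH] to the j-th copy through rH h. *)
Section InducedRepr.

Variables (F : fieldType) (gT : finGroupType) (G H : {group gT}) (d : nat).
Variable rH : mx_representation F H d.

Definition ind_rep_elt (i : 'I_#|rcosets H G|) : gT := repr (enum_val i).

Definition ind_block (x : gT) (i j : 'I_#|rcosets H G|) : 'M[F]_d :=
  let h := (ind_rep_elt i * x * (ind_rep_elt j)^-1)%g in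
  if h \in H then rH h else 0.

Definition ind_mx (x : gT) : 'M[F]_(\sum_(i < #|rcosets H G|) d) :=
  \mxblock_(i < #|rcosets H G|, j < #|rcosets H G|) ind_block x i j.

Lemma ind_rep_eltP i : enum_val i = (H :* ind_rep_elt i)%g.
Proof.
have /rcosetsP[x _ Ex] := enum_valP i.
by rewrite /ind_rep_elt Ex rcoset_repr.
Qed.

Lemma ind_blockE x i j :
  ((ind_rep_elt i * x * (ind_rep_elt j)^-1)%g \in H) =
  ((enum_val i :* x)%g == enum_val j).
Proof.
rewrite !ind_rep_eltP -mem_rcoset -rcosetM.
exact: (sameP rcoset_eqP eqP).
Qed.

Fact ind_mx_repr : mx_repr G ind_mx.
Proof.
split=> [|x y Gx Gy].
  rewrite /ind_mx -mxdiagZ; apply/eq_mxblock=> i j.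
  rewrite /ind_block ind_blockE rcoset1 (inj_eq enum_val_inj).
  case: eqVneq => [->|//]; rewrite mulg1 mulgV repr_mx1 conform_mx_id //.
rewrite /ind_mx mul_mxblock; apply/eq_mxblock=> i k.
have Cx : (enum_val i :* x)%g \in rcosets H G.
  have /rcosetsP[z Gz ->] := enum_valP i.
  by rewrite -rcosetM -rcosetE imset_f // groupM.
set j := enum_rank_in Cx (enum_val i :* x)%g.
have Ej : enum_val j = (enum_val i :* x)%g by rewrite enum_rankK_in.
rewrite (bigD1 j) //= big1 ?addr0; last first.
  move=> l; rewrite -(inj_eq enum_val_inj) Ej eq_sym => nl.
  by rewrite /ind_block ind_blockE (negPf nl) mul0mx.
rewrite /ind_block !ind_blockE Ej eqxx rcosetM.
case: ifP => [Hy|]; last by rewrite mulmx0.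
rewrite -repr_mxM ?ind_blockE ?Ej //.
by congr (rH _); rewrite !mulgA mulgKV.
Qed.

Definition ind_repr : mx_representation F G (\sum_(i < #|rcosets H G|) d) :=
  MxRepresentation ind_mx_repr.

End InducedRepr.

Arguments ind_repr {F gT} G {H d} rH.

(* Over algC this affords the induced class function of the library. *)
Lemma cfRepr_ind (gT : finGroupType) (G H : {group gT}) (d : nat)
    (rH : mx_representation algC H d) :
  H \subset G -> cfRepr (ind_repr G rH) = 'Ind[G] (cfRepr rH).
Proof.
move=> sHG; apply/cfun_inP=> x Gx; rewrite cfIndE // cfunE Gx mulr1n.
rewrite mxtrace_mxblock (reindex_inj invg_inj) /=.
under [in RHS]eq_bigl do rewrite groupV.
rewrite (set_partition_big _ (rcosets_partition sHG)) /= mulr_sumr.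
rewrite [RHS]big_enum_val /=; apply: eq_bigr => i _.
have conj_const y : y \in enum_val i ->
    cfRepr rH (x ^ y^-1)%g = cfRepr rH (x ^ (ind_rep_elt i)^-1)%g.
  rewrite ind_rep_eltP => /rcosetP[h Hh ->].
  by rewrite invMg conjgM [LHS]cfunJ ?groupV.
rewrite (eq_bigr _ conj_const).
rewrite sumr_const ind_rep_eltP card_rcoset -[X in _ * X]mulr_natl.
rewrite mulKf ?neq0CG // cfunE conjgE invgK mulgA /ind_block.
by case: ifP => _; rewrite ?mulr1n ?mulr0n ?mxtrace0.
Qed.

(* The number of summands isomorphic to the irreducible [rS] in a decomposition
   of [rG] as a direct sum of irreducibles. *)
Definition has_multiplicity (F : fieldType) (gT : finGroupType)
    (G : {group gT}) (d n : nat) (rS : mx_representation F G d)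
    (rG : mx_representation F G n) (k : nat) : Prop :=
  exists (I : finType) (W : I -> 'M[F]_n) (J : {set I}),
    [/\ forall i, mxsimple rG (W i),
        (\sum_i W i :=: 1%:M)%MS,
        mxdirect (\sum_i W i),
        forall i, i \in J <->
          exists modW : mxmodule rG (W i), mx_rsim (submod_repr modW) rS &
        #|J| = k].

Definition rho_plus (F : fieldType) (n : nat) (c : 'S_n) :=
  ind_repr [set: 'S_n]%G (triv_repr F <[c]>%G).

(* Main.v *)
Require Import Defs.
From mathcomp Require Import all_boot all_order all_algebra.
From mathcomp Require Import all_fingroup all_solvable all_field all_character.
From mathcomp Require Import reals complex.
From mathcomp Require Import ring.

(** Write [H] for the cyclic group generated by the full cycle [c] and let [phi]
    be the totient function.

    The trace of the induced representation at [g] is the number of [x] with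
    [g ^ x \in H], divided by [n] ([ind_triv_trace]). As [H] is regular on the
    [n] points, an element of order [b] in [H] has cycle type [b^(n/b)]
    ([cycle_type_full_cycle]), and [H] has [phi b] of them. Permutations with
    the same cycle type are conjugate ([cycle_type_conj]), so each of these
    [phi b] elements is [g ^ x] for [n! / #|C|] elements [x] when [g] lies in
    the class [C] of type [b^(n/b)]. The trace is thus
    [n! / #|C| * (phi b / n)] on such a class and [0] on all the others
    ([card_conj_full_cycle], [card_conj_full_cycle0]).

    It remains to see that [omega_n] has total mass [phi b / n], up to sign, on
    the class of type [b^a], where [a * b = n] ([omega_class_rect]). The Euler
    products of the sums of [mu d] and of [mu d / d] over the divisors [d] of
    [b] give the value of the necklace polynomial [M_b] at 1, namely [1] if
    [b = 1] and [0] otherwise, and its derivative there, namely [phi b / b].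
    Cancelling a factor [X - 1] and evaluating at 1 amounts to differentiating
    at 1. For [1 < b] the derivative of [binomial(M_b, a)] at 1 is
    [(-1)^(a-1) (phi b / b) / a]. For [b = 1] the derivative of [binomial(X, n)]
    at 1 is [(-1)^n / (n (n-1))], and the recursion then gives the value
    [(-1)^(n-1) / n] to [omega_n].

    The degree is the index of [H]. The multiplicity of a linear character
    [chi] in the induced representation is [1] if [chi] is trivial on [H] and [0]
    otherwise ([ind_triv_multiplicity]); the sign character is trivial on [H] iff
    [c] is even, that is, iff [n] is odd. The trivial representation is thus a
    constituent, of degree 1, and [1 < (n-1)!] for [2 < n], whence
    reducibility ([linear_constituent_reducible]). *)

Set Implicit Arguments.
Unset Strict Implicit.
Unset Printing Implicit Defensive.

Import Order.TTheory GRing.Theory Num.Theory.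

(** * Cycle types and conjugacy of permutations *)

Section Porbits.
Variable T : finType.
Implicit Types (s : {perm T}) (x y : T).

(** Exponents only matter modulo the length of the cycle through [x]; this lets
    a point of a cycle be located by an exponent without normalising it. *)
Lemma eq_porbit_expg s x k l :
  ((s ^+ k)%g x == (s ^+ l)%g x) = (k == l %[mod #|porbit s x|]).
Proof.
set N := #|porbit s x|.
have N0 : 0 < N by rewrite lt0n card_porbit_neq0.
have red m : (s ^+ m)%g x = (s ^+ (m %% N))%g x.
  rewrite {1}(divn_eq m N) expgD permM mulnC expgM; congr (_ _).
  elim: (m %/ N) => [|q IHq]; first by rewrite perm1.
  by rewrite expgS permM (permX s x N) iter_porbit.
have lt m : m %% N < size (traject s x N) by rewrite size_traject ltn_mod.
have := nth_uniq x (lt k) (lt l) (uniq_traject_porbit s x).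
by rewrite !nth_traject ?ltn_mod // (red k) (red l) !permX.
Qed.

Lemma porbits_partition s : partition (porbits s) [set: T].
Proof.
apply/and3P; split.
- rewrite eqEsubset subsetT; apply/subsetP => x _.
  by apply/bigcupP; exists (porbit s x); rewrite ?imset_f ?porbit_id.
- apply/trivIsetP => _ _ /imsetP[x _ ->] /imsetP[y _ ->].
  apply: contraNT => /pred0Pn[z /= /andP[]].
  rewrite -!eq_porbit_mem => /eqP -> /eqP ->; exact: eqxx.
- by apply/imsetP => -[x _ /setP/(_ x)]; rewrite inE porbit_id.
Qed.

Lemma porbitJ s (t : {perm T}) x : porbit (s ^ t)%g (t x) = t @: porbit s x.
Proof.
apply/setP => y; apply/porbitP/imsetP => [[k ->]|[_ /porbitP[k ->] ->]].
  by exists ((s ^+ k)%g x); rewrite ?mem_porbit // -conjXg permJ.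
by exists k; rewrite -conjXg permJ.
Qed.

Lemma porbitsJ s (t : {perm T}) :
  porbits (s ^ t)%g = (fun A : {set T} => t @: A) @: porbits s.
Proof.
apply/setP => A; apply/imsetP/imsetP => [[x _ ->]|[_ /imsetP[x _ ->] ->]].
  exists (porbit s (t^-1 x)%g); first exact: imset_f.
  by rewrite -porbitJ permKV.
by exists (t x); rewrite ?porbitJ.
Qed.

End Porbits.

Lemma geq_total : total geq. Proof. by move=> x y; exact: leq_total. Qed.
Lemma geq_trans : transitive geq.
Proof. by move=> y x z /= h1 h2; exact: leq_trans h2 h1. Qed.
Lemma geq_anti : antisymmetric geq.
Proof. by move=> x y; rewrite /= andbC -eqn_leq => /eqP. Qed.

Lemma cycle_typeJ n (g x : 'S_n) : cycle_type (g ^ x)%g = cycle_type g.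
Proof.
apply/(perm_sortP geq_total geq_trans geq_anti).
have inj : injective (fun A : {set 'I_n} => x @: A).
  exact: imset_inj (@perm_inj _ x).
have /(perm_map (fun A : {set 'I_n} => #|A|)) :
    perm_eq (enum (porbits (g ^ x)%g))
            (map (fun A : {set 'I_n} => x @: A) (enum (porbits g))).
  apply: uniq_perm; rewrite ?enum_uniq ?map_inj_uniq ?enum_uniq // => A.
  rewrite mem_enum porbitsJ; apply/imsetP/mapP => -[B PB ->];
    by exists B; rewrite ?mem_enum in PB *.
move/perm_trans; apply; rewrite -map_comp.
rewrite (eq_map (g := fun A : {set 'I_n} => #|A|)) // => A /=.
by rewrite card_imset //; apply: perm_inj.
Qed.

(** Sorting the cycles of [g] and of [h] by length pairs them off, length by
    length; once a base point is chosen on each cycle, sending the [k]-th iterate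
    of the base point of a cycle of [g] to the [k]-th iterate of the base point
    of its partner is a permutation that conjugates [g] into [h]. *)
Theorem cycle_type_conj n (g h : 'S_n) :
  cycle_type g = cycle_type h -> exists x, h = (g ^ x)%g.
Proof.
case: n g h => [g h _|n g h].
  by exists 1%g; apply/permP => -[].
pose cyc (s : 'S_n.+1) :=
  sort (relpre (fun A : {set 'I_n.+1} => #|A|) geq) (enum (porbits s)).
rewrite /cycle_type !sort_map -!/(cyc _) => Ecard.
have cycU s : uniq (cyc s) by rewrite sort_uniq enum_uniq.
have cycE s A : (A \in cyc s) = (A \in porbits s) by rewrite mem_sort mem_enum.
have Esize : size (cyc g) = size (cyc h) by move/(congr1 size): Ecard; rewrite !size_map.
(* [m] is the pairing of the cycles of [g] with those of [h]. *)
pose m X := nth set0 (cyc h) (index X (cyc g)).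
have ltm X : X \in porbits g -> index X (cyc g) < size (cyc h).
  by rewrite -Esize index_mem cycE.
have mP X : X \in porbits g -> m X \in porbits h.
  by move=> PX; rewrite -cycE mem_nth ?ltm.
have mcard X : X \in porbits g -> #|m X| = #|X|.
  move=> PX; rewrite -(nth_map _ 0 (fun A : {set 'I_n.+1} => #|A|)) ?ltm // -Ecard.
  by rewrite (nth_map set0) ?nth_index ?index_mem ?cycE.
have minj : {in porbits g &, injective m}.
  move=> X Y PX PY /eqP; rewrite nth_uniq ?ltm // => /eqP E.
  by rewrite -[X](nth_index set0 (s := cyc g)) ?cycE // E nth_index ?cycE.
(* The default value is irrelevant: [rep] is used on cycles, which are not
   empty. *)
pose rep (A : {set 'I_n.+1}) := odflt ord0 [pick y in A].
have repP (s : 'S_n.+1) A : A \in porbits s -> porbit s (rep A) = A.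
  case/imsetP => x _ ->; apply/eqP; rewrite eq_porbit_mem /rep.
  by case: pickP => [//|/(_ x)]; rewrite porbit_id.
have Pg x : porbit g x \in porbits g by rewrite imset_f.
have exk x : {k | x = (g ^+ k)%g (rep (porbit g x))}.
  by apply: sig_eqW; apply/porbitP; rewrite repP // porbit_id.
pose k x := sval (exk x).
have kP x : (g ^+ k x)%g (rep (porbit g x)) = x by rewrite -(svalP (exk x)).
pose f x := (h ^+ k x)%g (rep (m (porbit g x))).
have fP x : porbit h (f x) = m (porbit g x) by rewrite porbit_perm repP // mP.
have finj : injective f.
  move=> x y Ef; have Eo : porbit g x = porbit g y.
    by apply: minj => //; rewrite -!fP Ef.
  move/eqP: Ef; rewrite /f Eo eq_porbit_expg repP ?mP // mcard //.
  rewrite -(repP g (porbit g y)) // -eq_porbit_expg -{1}Eo !kP.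
  by move/eqP.
exists (perm finj); apply/permP => y.
rewrite -[y](permKV (perm finj)); move: (_ y) => x.
rewrite permJ !permE /f.
have Ego : porbit g (g x) = porbit g x.
  by have := porbit_perm g 1 x; rewrite expg1.
rewrite -permM -expgSr Ego; apply/eqP; rewrite eq_sym.
rewrite eq_porbit_expg repP ?mP // mcard // -(repP g (porbit g x)) //.
by rewrite -eq_porbit_expg -{1}Ego kP expgSr permM kP.
Qed.

(** * Conjugates inside the group generated by a full cycle *)

Lemma card_porbits_cycle_type n (g : 'S_n) : #|porbits g| = size (cycle_type g).
Proof. by rewrite size_sort size_map cardE. Qed.

Lemma cycle_type_uniform n (g : 'S_n) b :
  0 < n -> (forall x, #|porbit g x| = b) -> cycle_type g = nseq (n %/ b) b.
Proof.
move=> n0 gb.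
have En : n = #|porbits g| * b.
  rewrite -{1}(card_ord n) -cardsT.
  by apply: card_uniform_partition (porbits_partition g) => _ /imsetP[x _ ->].
have b0 : 0 < b by move: n0; rewrite {1}En muln_gt0 => /andP[].
have -> : n %/ b = size (cycle_type g).
  by rewrite -card_porbits_cycle_type {1}En mulnK.
apply/all_pred1P/allP => k; rewrite mem_sort => /mapP[A].
by rewrite mem_enum => /imsetP[x _ ->] -> /=; rewrite gb.
Qed.

Section FullCycle.
Variables (n : nat) (c : 'S_n).
Hypotheses (n0 : 0 < n) (hc : cycle_type c = [:: n]).

Lemma porbit_full x : porbit c x = [set: 'I_n].
Proof.
apply/eqP; rewrite eqEcard subsetT cardsT card_ord /=.
have : #|porbit c x| \in cycle_type c.
  by rewrite mem_sort; apply/mapP; exists (porbit c x); rewrite ?mem_enum ?imset_f.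
by rewrite hc inE => /eqP ->.
Qed.

(** The cyclic group [<[c]>] is transitive and abelian, hence acts regularly: a
    power of [h] that fixes one point commutes with a transitive group, so it
    fixes every point. *)
Lemma card_porbit_full_cycle h x : h \in <[c]>%g -> #|porbit h x| = #[h]%g.
Proof.
move=> /cycleP[m Eh]; apply/eqP; rewrite eqn_leq; apply/andP; split.
  by rewrite porbit.unlock leq_imset_card.
apply: dvdn_leq; first by rewrite lt0n card_porbit_neq0.
rewrite order_dvdn; apply/eqP/permP => y; rewrite perm1.
have /porbitP[k ->] : y \in porbit c x by rewrite porbit_full inE.
have cck : commute (h ^+ #|porbit h x|)%g (c ^+ k)%g.
  by rewrite Eh -!expgM; apply/commuteX2.
by rewrite -permM -cck permM (permX h) iter_porbit.
Qed.

Lemma order_full_cycle : #[c]%g = n.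
Proof.
rewrite -(card_porbit_full_cycle (Ordinal n0) (cycle_id c)).
by rewrite porbit_full cardsT card_ord.
Qed.

Lemma cycle_type_full_cycle h :
  h \in <[c]>%g -> cycle_type h = nseq (n %/ #[h]%g) #[h]%g.
Proof. by move=> hh; apply: cycle_type_uniform => // x; apply: card_porbit_full_cycle. Qed.

(** A full cycle has a single orbit, and the parity of a permutation is that of
    the number of points minus the number of orbits. *)
Lemma odd_full_cycle : odd_perm c = ~~ odd n.
Proof. by rewrite /odd_perm card_ord card_porbits_cycle_type hc addbT. Qed.

End FullCycle.

(** A cyclic group has a unique subgroup of order [b], and the elements of
    order [b] are its generators. *)
Lemma card_order_cycle (gT : finGroupType) (a : gT) b : b %| #[a]%g ->
  #|[set x in <[a]>%g | #[x]%g == b]| = totient b.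
Proof.
move=> ba; have oy := orderXdiv (dvdn_div ba).
rewrite divnA // mulKn // in oy.
rewrite -oy totient_gen; apply: eq_card => x; rewrite !inE /generator.
set y := (a ^+ _)%g in oy *; have ya : <[y]>%g \subset <[a]>%g by apply: cycleX.
apply/andP/eqP => [[xa /eqP ox]|E].
  apply/eqP; rewrite eq_sym.
  rewrite (eq_subG_cyclic (cycle_cyclic a)) ?cycle_subG ?mem_cycle //.
  exact/eqP.
rewrite -/(#[x]%g) /order -E; split=> //.
by apply: subsetP ya _ _; rewrite E cycle_id.
Qed.

(** The fibres of [x |-> g ^ x] are right cosets of the centraliser of [g]. *)
Lemma card_conj_into (gT : finGroupType) (G : {group gT}) (S : {set gT}) g :
  #|[set x in G | (g ^ x)%g \in S]| = #|S :&: (g ^: G)%g| * #|'C_G[g]%g|.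
Proof.
rewrite -sum1_card.
rewrite (partition_big (fun x => (g ^ x)%g) (mem (S :&: (g ^: G)%g))) /=; last first.
  by move=> x; rewrite !inE => /andP[Gx ->]; rewrite memJ_class.
rewrite -sum_nat_const; apply: eq_bigr => h; rewrite inE => /andP[Sh /imsetP[x0 Gx0 Eh]].
rewrite sum1_card -(card_rcoset _ x0); apply: eq_card => x.
rewrite [LHS]inE [X in X && _]inE mem_rcoset in_setI (groupMr _ (groupVr Gx0)).
rewrite cent1C cent1E [(g * _)%g]conjgC (inj_eq (mulgI _)) conjgM.
rewrite (can2_eq (conjgKV x0) (conjgK x0)) -Eh -andbA.
by case: eqP => [->|]; rewrite ?Sh ?andbF.
Qed.

Lemma card_cycle_class n (g : 'S_n) :
  (#|cycle_class n (cycle_type g)| * #|'C[g]%g| = n`!)%N.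
Proof.
have -> : cycle_class n (cycle_type g) = (g ^: [set: 'S_n])%g.
  apply/setP => h; rewrite inE; apply/eqP/imsetP => [|[x _ ->]]; last exact: cycle_typeJ.
  by move/esym/cycle_type_conj => [x ->]; exists x; rewrite ?inE.
by rewrite -index_cent1 setTI mulnC Lagrange ?subsetT // cardsT card_Sn.
Qed.

(** Among the elements of [<[c]>], the conjugates of [g] are those of order
    [b], since order and cycle type determine each other there. *)
Lemma card_conj_full_cycle n (c : 'S_n) g b :
    0 < n -> cycle_type c = [:: n] -> b %| n -> cycle_type g = nseq (n %/ b) b ->
  #|[set x | (g ^ x)%g \in <[c]>%g]| * #|cycle_class n (cycle_type g)|
    = totient b * n`!.
Proof.
move=> n0 hc bn Eg; have b0 : 0 < b := dvdn_gt0 n0 bn.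
have nb : 0 < n %/ b by rewrite divn_gt0 // dvdn_leq.
have -> : [set x | (g ^ x)%g \in <[c]>%g] =
          [set x in [set: 'S_n] | (g ^ x)%g \in <[c]>%g].
  by apply/setP => x; rewrite !inE.
rewrite card_conj_into setTI -mulnA [(_ * #|cycle_class _ _|)%N]mulnC card_cycle_class.
congr (_ * _)%N; rewrite -(card_order_cycle (a := c)) ?(order_full_cycle n0 hc) //.
apply: eq_card => h; rewrite [LHS]inE [RHS]inE; case hh: (h \in <[c]>%g) => //=.
have Eh := cycle_type_full_cycle n0 hc hh.
apply/imsetP/eqP => [[x _ E]|oh].
  have : b \in nseq (n %/ b) b by rewrite mem_nseq nb eqxx.
  by rewrite -Eg -(cycle_typeJ g x) -E Eh mem_nseq => /andP[_ /eqP].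
have /cycle_type_conj[x ->] : cycle_type g = cycle_type h by rewrite Eg Eh oh.
by exists x; rewrite ?inE.
Qed.

Lemma card_conj_full_cycle0 n (c : 'S_n) g :
    0 < n -> cycle_type c = [:: n] ->
    (forall b, b %| n -> cycle_type g <> nseq (n %/ b) b) ->
  #|[set x | (g ^ x)%g \in <[c]>%g]| = 0.
Proof.
move=> n0 hc Ng; apply: eq_card0 => x; rewrite inE; apply/negP => gx.
apply: (Ng #[(g ^ x)%g]%g); last by rewrite -(cycle_type_full_cycle n0 hc gx) cycle_typeJ.
by rewrite -[X in _ %| X](order_full_cycle n0 hc) order_dvdG.
Qed.

Local Open Scope ring_scope.

(** * The measures [omega_n] *)

(** Induction along the prime factorisation, for statements about arithmetic
    functions that are multiplicative. *)
Lemma coprime_prime_power_ind (P : nat -> Prop) :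
    P 1%N ->
    (forall p k m, prime p -> (0 < m)%N -> coprime p m -> P m ->
       P (p ^ k.+1 * m)%N) ->
  forall n, (0 < n)%N -> P n.
Proof.
move=> P1 PM n; have [N] := ubnP n; elim: N n => // N IHN n leN n0.
have [n1|n1] := leqP n 1; first by have /eqP <- : 1%N == n by rewrite eqn_leq n0.
have pp := pdiv_prime n1; have [m cpm En] := pfactor_coprime pp n0.
have lp : (0 < logn (pdiv n) n)%N by rewrite logn_gt0 mem_primes pp n0 pdiv_dvd.
have m0 : (0 < m)%N by move: n0; rewrite En muln_gt0 => /andP[].
rewrite En mulnC -(prednK lp); apply: PM => //; apply: IHN => //.
rewrite -ltnS; apply: leq_trans leN; rewrite ltnS [X in (_ < X)%N]En ltn_Pmulr //.
by rewrite -(exp1n (logn (pdiv n) n)) ltn_exp2r // prime_gt1.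
Qed.

Lemma moebius_primeM p d :
  prime p -> (0 < d)%N -> coprime p d -> moebius (p * d)%N = - moebius d.
Proof.
move=> pp d0 cpd; have p0 := prime_gt0 pp.
have pNd : p \notin primes d.
  by rewrite mem_primes pp d0 /= -prime_coprime.
have Epr : perm_eq (primes (p * d)%N) (p :: primes d).
  apply: uniq_perm; first exact: primes_uniq.
    by rewrite /= pNd primes_uniq.
  by move=> q; rewrite primesM // primes_prime // !in_cons orbF.
rewrite /moebius (perm_all _ Epr) (perm_size Epr) /= lognM //.
rewrite logn_prime // eqxx logn_coprime // addn0 eqxx /=.
rewrite exprS mulN1r (eq_in_all (a2 := fun q => logn q d == 1%N)) => [|q qd].
  by case: ifP; rewrite ?oppr0.
rewrite lognM // logn_prime //; case: (eqVneq q p) => // Eq.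
by rewrite -Eq qd in pNd.
Qed.

Lemma moebius_dvd_sqr p d :
  prime p -> (0 < d)%N -> (p ^ 2 %| d)%N -> moebius d = 0.
Proof.
move=> pp d0; rewrite pfactor_dvdn // => l2; rewrite /moebius ifF //.
apply/allP => /(_ p); rewrite mem_primes pp d0 /=.
rewrite -[(p %| d)%N]/(p ^ 1 %| d)%N pfactor_dvdn // (ltnW l2).
by move=> /(_ isT) /eqP E; rewrite E in l2.
Qed.

(** One factor of the Euler product. A divisor [d] of [p ^ k.+1 * m] with
    [moebius d != 0] is either a divisor of [m] or [p] times one, and the
    Moebius function changes sign from the former to the latter. *)
Lemma moebius_sum_primeM (f : nat -> rat) p k m :
    (forall d, f (p * d)%N = f p * f d) ->
    prime p -> (0 < m)%N -> coprime p m ->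
  \sum_(d <- divisors (p ^ k.+1 * m)) moebius d * f d =
  (1 - f p) * \sum_(d <- divisors m) moebius d * f d.
Proof.
move=> fM pp m0 cpm; have p0 := prime_gt0 pp.
have n0 : (0 < p ^ k.+1 * m)%N by rewrite muln_gt0 expn_gt0 p0.
have pos n d : (0 < n)%N -> d \in divisors n -> (0 < d)%N.
  by move=> ?; rewrite -dvdn_divisors // => /dvdn_gt0; apply.
rewrite (bigID (fun d => p ^ 2 %| d)%N) /= big_seq_cond big1 => [|d /andP[dn pd]].
  rewrite add0r -big_filter.
  have Edv : perm_eq [seq d <- divisors (p ^ k.+1 * m) | ~~ (p ^ 2 %| d)%N]
                   (divisors m ++ map (muln p) (divisors m)).
    apply: uniq_perm.
    - by rewrite filter_uniq // divisors_uniq.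
    - rewrite cat_uniq divisors_uniq map_inj_uniq ?divisors_uniq ?andbT; last first.
        by move=> x y /eqP; rewrite eqn_pmul2l // => /eqP.
      apply/hasPn => _ /mapP[d _ ->]; rewrite -dvdn_divisors //.
      apply/negP => /(dvdn_trans (dvdn_mulr d (dvdnn p))).
      by apply/negP; rewrite -prime_coprime.
    move=> d; rewrite mem_filter mem_cat -!dvdn_divisors //.
    have [pd|pNd] := boolP (p %| d)%N; last first.
      have cpd : coprime p d by rewrite prime_coprime.
      rewrite Gauss_dvdr ?coprimeXr // 1?coprime_sym //.
      have -> : (p ^ 2 %| d)%N = false.
        by apply: contraNF pNd; apply: dvdn_trans; rewrite dvdn_exp.
      case: (d %| m)%N => //=; apply/esym/mapP => -[e _ Ed].
      by rewrite Ed dvdn_mulr in pNd.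
    have -> : (d %| m)%N = false.
      by apply/negP => /(dvdn_trans pd); apply/negP; rewrite -prime_coprime.
    case/dvdnP: pd => e ->; rewrite mulnC expnS mulnC expn1 dvdn_pmul2l //=.
    rewrite (mem_map (f := muln p)); last first.
      by move=> x y /eqP; rewrite eqn_pmul2l // => /eqP.
    rewrite -dvdn_divisors // expnS -mulnA dvdn_pmul2l //.
    rewrite -prime_coprime //; case: (boolP (coprime p e)) => cpe /=.
      by rewrite Gauss_dvdr // coprimeXr // coprime_sym.
    apply/esym; apply: contraNF cpe => em.
    by rewrite coprime_sym (coprime_dvdl em) // coprime_sym.
  rewrite (perm_big _ Edv) big_cat big_map /= mulrBl mul1r; congr (_ + _).
  rewrite mulr_sumr -sumrN big_seq [RHS]big_seq; apply: eq_bigr => d dm.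
  have d0 := pos m d m0 dm.
  have cpd : coprime p d.
    by move: dm; rewrite -dvdn_divisors // => /coprime_dvdr; apply.
  by rewrite moebius_primeM // fM mulNr mulrCA.
by rewrite (moebius_dvd_sqr pp) ?mul0r // (pos (p ^ k.+1 * m)%N).
Qed.

Lemma moebius_sum n : (0 < n)%N ->
  \sum_(d <- divisors n) moebius d = (n == 1%N)%:R.
Proof.
move: n; apply: coprime_prime_power_ind => [|p k m pp m0 cpm _].
  by rewrite big_seq1.
have -> : (p ^ k.+1 * m == 1)%N = false.
  by rewrite muln_eq1 expnS muln_eq1; case: (p) pp => [|[|?]].
under eq_bigr do rewrite -[moebius _]mulr1.
by rewrite (@moebius_sum_primeM (fun=> 1)) ?subrr ?mul0r // => d; rewrite mulr1.
Qed.

Lemma moebius_sum_inv n : (0 < n)%N ->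
  \sum_(d <- divisors n) moebius d / d%:R = (totient n)%:R / n%:R.
Proof.
move: n; apply: coprime_prime_power_ind => [|p k m pp m0 cpm IHm].
  by rewrite big_seq1.
rewrite (moebius_sum_primeM (f := fun d => d%:R^-1)) // => [|d]; last first.
  by rewrite natrM invfM.
rewrite {}IHm totient_coprime ?coprimeXl // totient_pfactor //=.
have p0 : p%:R != 0 :> rat by rewrite pnatr_eq0 -lt0n prime_gt0.
have pk0 : (p ^ k)%:R != 0 :> rat by rewrite pnatr_eq0 -lt0n expn_gt0 prime_gt0.
have mR0 : m%:R != 0 :> rat by rewrite pnatr_eq0 -lt0n.
rewrite expnS !natrM -subn1 natrB ?prime_gt0 //; field.
by rewrite p0 pk0 mR0.
Qed.

Lemma necklace_at1 m : (0 < m)%N -> (necklace m).[1] = (m == 1%N)%:R.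
Proof.
move=> m0; rewrite hornerZ horner_sum (eq_bigr moebius) => [|d _].
  by rewrite moebius_sum //; case: eqP => [->|_]; rewrite ?invr1 ?mulr0 ?mulr1.
by rewrite hornerZ hornerXn expr1n mulr1.
Qed.

Lemma deriv_necklace_at1 m :
  (0 < m)%N -> (necklace m)^`().[1] = (totient m)%:R / m%:R.
Proof.
move=> m0; rewrite derivZ hornerZ raddf_sum horner_sum -moebius_sum_inv //.
rewrite mulr_sumr big_seq [RHS]big_seq; apply: eq_bigr => d.
rewrite -dvdn_divisors // => /[dup] dm /dvdnP[e Em].
have d0 : (0 < d)%N by rewrite (dvdn_gt0 m0).
have e0 : (0 < e)%N by move: m0; rewrite Em muln_gt0 => /andP[].
rewrite /= derivZ hornerZ derivXn hornerMn hornerXn expr1n Em mulnK // natrM.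
rewrite mulrCA invfM mulrAC mulVf ?mul1r // pnatr_eq0 -lt0n //.
Qed.

Lemma natr_poly_horner (R : comNzRingType) k (x : R) : (k%:R : {poly R}).[x] = k%:R.
Proof. by rewrite -polyC_natr hornerC. Qed.

Lemma prod_opp_succ m : \prod_(i < m) - (i.+1%:R : rat) = (-1) ^+ m * m`!%:R.
Proof.
elim: m => [|m IHm]; first by rewrite big_ord0 mulr1.
by rewrite big_ord_recr /= IHm factS natrM exprS; ring.
Qed.

(** Since [t - i] takes the value [- i] at 1, the factor [i = 0] vanishes there,
    and the derivative of the product is that of [t] times the value of the
    remaining factors, a signed factorial. *)
Lemma binomial_poly_root_deriv0 (t : {poly rat}) m : t.[1] = 0 ->
  (binomial_poly t m.+1).[1] = 0 /\
  (binomial_poly t m.+1)^`().[1] = (-1) ^+ m * t^`().[1] / m.+1%:R.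
Proof.
move=> t0; rewrite /binomial_poly derivZ !hornerZ big_ord_recl /= subr0 derivM.
rewrite hornerD !hornerM t0 !mul0r mulr0 addr0; split=> //.
rewrite horner_prod (eq_bigr (fun i : 'I_m => - (i.+1)%:R)) => [|i _]; last first.
  by rewrite hornerD hornerN t0 sub0r natr_poly_horner.
have mf : m`!%:R != 0 :> rat by rewrite pnatr_eq0 -lt0n fact_gt0.
rewrite prod_opp_succ factS natrM invfM.
have mS0 : m.+1%:R != 0 :> rat by rewrite pnatr_eq0.
by field; rewrite nat1r mf mS0.
Qed.

(** The same computation when the vanishing factor is [i = 1]. *)
Lemma binomial_poly_root_deriv1 (t : {poly rat}) m : t.[1] = 1 ->
  (binomial_poly t m.+2).[1] = 0 /\
  (binomial_poly t m.+2)^`().[1] =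
    (-1) ^+ m * t^`().[1] / (m.+1%:R * m.+2%:R).
Proof.
move=> t1; rewrite /binomial_poly derivZ !hornerZ !big_ord_recl /= subr0.
rewrite !derivM derivB -polyC_natr derivC subr0.
rewrite !(hornerD, hornerM, hornerN) t1 hornerC subrr !mul0r !mulr0.
rewrite add0r mul1r addr0; split=> //.
rewrite horner_prod (eq_bigr (fun i : 'I_m => - (i.+1)%:R)) => [|i _]; last first.
  by rewrite hornerD hornerN t1 natr_poly_horner (natrD _ 1 i.+1) opprD addrA subrr add0r.
have mf : m`!%:R != 0 :> rat by rewrite pnatr_eq0 -lt0n fact_gt0.
rewrite prod_opp_succ !factS !natrM.
have mS0 : m.+1%:R != 0 :> rat by rewrite pnatr_eq0.
have mSS0 : m.+2%:R != 0 :> rat by rewrite pnatr_eq0.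
by field; rewrite nat1r -natrD mf mS0 mSS0.
Qed.

Lemma cycle_poly_nseq n a b : (0 < b <= n)%N ->
  cycle_poly n (nseq a b) = binomial_poly (necklace b) a.
Proof.
case/andP=> b0 bn; rewrite /cycle_poly.
rewrite (bigD1_seq b) ?iota_uniq //=; last by rewrite mem_index_iota b0.
rewrite count_nseq /= eqxx mul1n big1 ?mulr1 // => j nj.
by rewrite count_nseq /= eq_sym (negPf nj) /binomial_poly big_ord0 invr1 scale1r.
Qed.

(** Cancelling a factor ['X - 1] and evaluating at 1 is differentiating at 1. *)
Lemma splitting_deriv n lam :
  (cycle_poly n lam).[1] = 0 -> splitting n lam = (cycle_poly n lam)^`().[1].
Proof.
move/eqP/factor_theorem => [q Eq]; rewrite /splitting Eq hornerXn expr1n divr1.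
rewrite -polyC1 mulpK ?polyXsubC_eq0 // derivM derivB derivX derivC subr0.
by rewrite hornerD !hornerM hornerXsubC subrr hornerC mulr0 add0r mulr1.
Qed.

Lemma splitting_rect a b : (1 < b)%N ->
  splitting (a.+1 * b) (nseq a.+1 b) =
  (-1) ^+ a * (totient b)%:R / (a.+1 * b)%:R.
Proof.
move=> b1; have b0 := ltnW b1.
have [|r0 rD] := @binomial_poly_root_deriv0 (necklace b) a.
  by rewrite necklace_at1 // gtn_eqF.
have bn : (0 < b <= a.+1 * b)%N by rewrite b0 leq_pmull.
rewrite splitting_deriv cycle_poly_nseq // rD deriv_necklace_at1 //.
by rewrite natrM invfM -!mulrA (mulrC b%:R^-1).
Qed.

Lemma splitting_id m :
  splitting m.+2 (nseq m.+2 1) = (-1) ^+ m / (m.+1%:R * m.+2%:R).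
Proof.
have [|r0 rD] := @binomial_poly_root_deriv1 (necklace 1) m; first exact: necklace_at1.
rewrite splitting_deriv cycle_poly_nseq // rD deriv_necklace_at1 //.
by rewrite (_ : totient 1 = 1%N) // divff ?oner_eq0 // mulr1.
Qed.

Lemma omega_classE n lam : omega_class n.+2 lam =
  if is_rectangular n.+2 lam then splitting n.+2 lam
  else if lam == nseq n.+2 1%N
  then splitting n.+2 lam - omega_class n.+1 (nseq n.+1 1%N)
  else 0.
Proof. by []. Qed.

(** The recursion preserves the shape [+- 1 / n] because of the identity
    [1 / (n (n + 1)) - 1 / n = - 1 / (n + 1)]. *)
Lemma omega_class_id n :
  omega_class n.+1 (nseq n.+1 1%N) = (-1) ^+ n / n.+1%:R.
Proof.
elim: n => [|n IHn]; first by rewrite /= divr1.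
rewrite omega_classE ifF ?eqxx ?{}IHn ?splitting_id.
  rewrite exprS.
  have mS0 : n.+1%:R != 0 :> rat by rewrite pnatr_eq0.
  have mSS0 : n.+2%:R != 0 :> rat by rewrite pnatr_eq0.
  by field; rewrite nat1r -natrD mS0 mSS0.
apply/hasP => -[b bn /andP[b1 /eqP E]].
have: 1%N \in nseq n.+2 1%N by rewrite mem_nseq eqxx.
by rewrite E mem_nseq => /andP[_ /eqP b1']; rewrite -b1' in b1.
Qed.

(** The signs [(-1) ^+ a] disappear in the absolute value, and the identity
    class turns out to follow the same rule as the classes with [1 < b]. *)
Lemma omega_class_rect n b : (0 < n)%N -> (b %| n)%N ->
  `|omega_class n (nseq (n %/ b) b)| = (totient b)%:R / n%:R.
Proof.
case: n => // n _ bn; have b0 := dvdn_gt0 (isT : 0 < n.+1)%N bn.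
case: (ltngtP b 1) => [|b1|->]; first by case: (b) b0.
  case: n bn => [|n] bn; first by rewrite (eqP (_ : b == 1)%N) -?dvdn1 in b1.
  have -> : omega_class n.+2 (nseq (n.+2 %/ b) b) = splitting n.+2 (nseq (n.+2 %/ b) b).
    rewrite omega_classE ifT //; apply/hasP; exists b; last by rewrite b1 eqxx.
    by rewrite -dvdn_divisors.
  case/dvdnP: bn => -[//|a] ->; rewrite mulnK // splitting_rect //.
  by rewrite !normrM normfV normrX normrN1 expr1n mul1r !normr_nat.
by rewrite divn1 omega_class_id normrM normfV normrX normrN1 expr1n normr_nat.
Qed.

Lemma omega_class_neq0 n lam : omega_class n lam != 0 ->
  exists2 b, (b %| n)%N & lam = nseq (n %/ b) b.
Proof.
case: n => [|[|n]]; first by rewrite eqxx.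
  rewrite /=; case: (lam =P [:: 1%N]) => [-> _|_]; last by rewrite eqxx.
  by exists 1%N.
rewrite omega_classE; case: ifP => [/hasP[b bn /andP[_ /eqP E]] _|_].
  by exists b; rewrite ?dvdn_divisors.
case: (lam =P nseq n.+2 1%N) => [-> _|_]; last by rewrite eqxx.
by exists 1%N; rewrite ?divn1.
Qed.

(** * Multiplicity of linear representations *)

Section LinearMultiplicity.
Variables (F : decFieldType) (gT : finGroupType) (G : {group gT}).

(** Let [E] be the space of vectors on which [G] acts through the linear
    character of [rS]. In any decomposition into simple modules the summands
    isomorphic to [rS] are the ones contained in [E], and all of them are lines.
    Conversely the components of a vector of [E] lie in [E] by uniqueness of
    the decomposition, and a simple summand that meets [E] nontrivially is
    contained in it; so [E] is the direct sum of these lines, and its dimension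
    counts them. *)
Lemma linear_multiplicity n (rG : mx_representation F G n)
    (rS : mx_representation F G 1) m (E : 'M_(m, n)) :
    ([pchar F]^').-group%g G ->
    (forall u : 'rV_n,
      (u <= E)%MS <-> {in G, forall x, u *m rG x = rS x 0 0 *: u}) ->
  has_multiplicity rS rG (\rank E).
Proof.
move=> charG EP.
have EPm k (A : 'M_(k, n)) :
    (A <= E)%MS <-> {in G, forall x, A *m rG x = rS x 0 0 *: A}.
  split=> [AE x Gx | AE].
    apply/row_matrixP => i; rewrite row_mul linearZ /=.
    by have /EP-> := submx_trans (row_sub i A) AE.
  apply/row_subP => i; apply/EP => x Gx.
  by rewrite -row_mul AE // linearZ.
have modE k (A : 'M_(k, n)) : (A <= E)%MS -> mxmodule rG A.
  by move/EPm => AE; apply/mxmoduleP => x Gx; rewrite AE // scalemx_sub.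
have simE k (A : 'M_(k, n)) W :
    (A <= E)%MS -> mxsimple rG W -> (A <= W)%MS -> A != 0 -> (W <= A)%MS.
  move=> AE [_ _ minW] AW nzA; rewrite -(genmxE A); apply: minW.
  - by apply: modE; rewrite genmxE.
  - by rewrite genmxE.
  - by rewrite -mxrank_eq0 genmxE mxrank_eq0.
have [I W W' simW defW dxW] : mxsemisimple rG 1%:M.
  exact: dec_mx_reducible_semisimple (mxmodule1 _) (mx_Maschke_pchar rG charG).
rewrite /W' in defW dxW => {W'}.
have rank1 i : (W i <= E)%MS -> \rank (W i) = 1%N.
  move=> WE; have [_ nzW _] := simW i.
  apply/eqP; rewrite eqn_leq lt0n mxrank_eq0 nzW andbT.
  have nzu : nz_row (W i) != 0 by rewrite nz_row_eq0.
  have su := nz_row_sub (W i).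
  apply: leq_trans (mxrankS (simE _ _ _ (submx_trans su WE) (simW i) su nzu)) _.
  exact: rank_leq_row.
exists I, W, [set i | (W i <= E)%MS]; split=> // [i|].
  rewrite inE; split=> [WE | [modW [B n1 fB homB]]].
    have [modW nzW _] := simW i; exists modW.
    have rW := rank1 i WE.
    (* Both sides act by scalars, so any isomorphism of vector spaces will do. *)
    exists (pid_mx 1) => // [|x Gx]; first by rewrite /row_free rank_pid_mx ?rW.
    rewrite [rS x]mx11_scalar mul_mx_scalar /= /submod_mx.
    have /EPm-> // : (val_submod (1%:M : 'M_(\rank (W i))) <= E)%MS.
      by rewrite val_submod1.
    by rewrite linearZ /= val_submodK -scalemxAl mul1mx.
  apply/EPm => x Gx.
  have Esub : submod_repr modW x = (rS x 0 0)%:M.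
    apply: (row_free_inj fB); rewrite homB // mul_scalar_mx.
    by rewrite [rS x in LHS]mx11_scalar mul_mx_scalar.
  rewrite -{1}(in_submodK (submx_refl (W i))) -(val_submodJ modW) // Esub.
  by rewrite mul_mx_scalar linearZ /= in_submodK.
have dxJ : mxdirect (\sum_(i in [set i | (W i <= E)%MS]) W i).
  apply/mxdirect_sumsP => i _; apply/eqP; rewrite -submx0.
  have /mxdirect_sumsP/(_ i isT) dx0 := dxW.
  rewrite -[X in (_ <= X)%MS]dx0; apply: capmxS => //.
  by apply/sumsmx_subP => j /andP[_ nj]; apply: (sumsmx_sup j).
have -> : \rank E = \rank (\sum_(i in [set i | (W i <= E)%MS]) W i)%MS.
  apply/eqP; rewrite eqn_leq; apply/andP; split; apply: mxrankS; last first.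
    by apply/sumsmx_subP => i; rewrite inE.
  have sEW k (A : 'M_(k, n)) : (A <= \sum_i W i)%MS by rewrite defW submx1.
  have [A sAW EA _] := sub_dsumsmx dxW (sEW _ E).
  have AE i : (A i <= E)%MS.
    apply/EPm => x Gx.
    (* Two decompositions of [chi x *: E], where [chi] is the character of [rS]:
       act by [x] on the components of [E], or scale them. *)
    have [D _ _ uniqD] := sub_dsumsmx dxW (sEW _ (rS x 0 0 *: E)).
    rewrite (uniqD (fun i => A i *m rG x)) ?(uniqD (fun i => rS x 0 0 *: A i)) //.
    - by move=> j _; rewrite scalemx_sub ?sAW.
    - by rewrite {1}EA scaler_sumr.
    - move=> j _; have [modW _ _] := simW j.
      by rewrite mxmodule_trans ?sAW.
    - by rewrite -mulmx_suml -EA; have /EPm-> := submx_refl E.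
  rewrite {1}EA summx_sub // => i _; have [-> | nzA] := eqVneq (A i) 0.
    exact: sub0mx.
  apply: (sumsmx_sup i); last exact: sAW.
  by rewrite inE (submx_trans (simE _ _ _ (AE i) (simW i) (sAW i isT) nzA)).
rewrite (mxdirectP dxJ) /= -sum1_card; apply: eq_bigr => i; rewrite inE => WE.
by rewrite rank1.
Qed.

End LinearMultiplicity.

(** * The representation induced from the trivial one *)

Lemma submxrow_mul_mxblock (F : fieldType) n (B : 'I_n -> 'I_n -> 'M[F]_1)
    (u : 'rV[F]_(\sum_(i < n) 1)) j :
  submxrow (u *m \mxblock_(i, j) B i j) j = \sum_i submxrow u i *m B i j.
Proof.
by rewrite -[u in LHS]submxrowK mul_mxrow_mxblock mxrowK.
Qed.

Lemma submxrowZ (F : fieldType) n a (u : 'rV[F]_(\sum_(i < n) 1)) j :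
  submxrow (a *: u) j = a *: submxrow u j.
Proof. by apply/matrixP => k l; rewrite !mxE. Qed.

Lemma submxrow0 (F : fieldType) n j :
  submxrow (0 : 'rV[F]_(\sum_(i < n) 1)) j = 0.
Proof. by apply/matrixP => k l; rewrite !mxE. Qed.

Section InducedTrivial.
Variables (F : fieldType) (gT : finGroupType) (G H : {group gT}).
Hypothesis sHG : H \subset G.
Local Notation rho := (ind_repr G (triv_repr F H)).
Local Notation N := #|rcosets H G|.

(** The coset of [t] is fixed by [g] iff [t * g * t^-1] lies in [H], so the sum
    over cosets of the diagonal blocks becomes, after multiplication by the
    order of [H], a count of elements of [G]. *)
Lemma ind_triv_trace g :
  \tr (rho g) * #|H|%:R = #|[set x in G | (g ^ x)%g \in H]|%:R.
Proof.
rewrite mxtrace_mxblock mulr_suml -[in RHS]sum1_card.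
under [in RHS]eq_bigl do rewrite inE.
rewrite big_mkcondr natr_sum (reindex_inj invg_inj) /=.
under [in RHS]eq_bigl do rewrite groupV.
rewrite (set_partition_big _ (rcosets_partition sHG)) /=.
rewrite [RHS]big_enum_val /=; apply: eq_bigr => i _.
have conj_const y : y \in enum_val i ->
    (if (g ^ y^-1)%g \in H then 1%N else 0%N)%:R =
    (if (g ^ (ind_rep_elt i)^-1)%g \in H then 1%N else 0%N)%:R :> F.
  rewrite ind_rep_eltP => /rcosetP[h Hh ->].
  by rewrite invMg conjgM (groupJr _ (groupVr Hh)).
rewrite (eq_bigr _ conj_const) sumr_const ind_rep_eltP card_rcoset.
rewrite conjgE invgK mulgA /ind_block mulr_natr.
by case: ifP => _; rewrite ?mxtrace1 ?mxtrace0.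
Qed.

(** [ind_repr G (triv_repr F H)] permutes the coordinates as [G] permutes the
    cosets of [H], so being an eigenvector for [chi] is a condition relating
    one coordinate to another. *)
Lemma ind_triv_fixed (chi : gT -> F) (u : 'rV_(\sum_(i < N) 1)) :
  {in G, forall x, u *m rho x = chi x *: u} <->
  (forall x (i j : 'I_N), x \in G -> (enum_val i :* x)%g = enum_val j ->
     submxrow u i = chi x *: submxrow u j).
Proof.
have unq x (i i' j : 'I_N) : (enum_val i :* x)%g = enum_val j ->
  (enum_val i' :* x)%g = enum_val j -> i' = i.
  by move=> <- /(can_inj (rcosetK x))/enum_val_inj.
have key x (i j : 'I_N) : (enum_val i :* x)%g = enum_val j ->
    submxrow (u *m rho x) j = submxrow u i.
  move=> Eij; rewrite /= /ind_mx submxrow_mul_mxblock (bigD1 i) //= big1 => [|k nk].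
    by rewrite addr0 /ind_block ind_blockE Eij eqxx mulmx1.
  rewrite /ind_block ind_blockE ifN ?mulmx0 //.
  by apply: contra nk => /eqP/(unq _ _ _ _ Eij) ->.
split=> [fixu x i j Gx Eij | fixu x Gx].
  by rewrite -(key _ _ _ Eij) fixu // submxrowZ.
rewrite -[LHS]submxrowK -[RHS]submxrowK; apply/eq_mxrow => j; rewrite submxrowZ.
have Cj : (enum_val j :* x^-1)%g \in rcosets H G.
  have /rcosetsP[z Gz ->] := enum_valP j.
  by rewrite -rcosetM -rcosetE imset_f // groupM ?groupV.
pose i := enum_rank_in Cj (enum_val j :* x^-1)%g.
have Eij : (enum_val i :* x)%g = enum_val j.
  by rewrite enum_rankK_in // rcosetKV.
by rewrite (key _ _ _ Eij); apply: fixu.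
Qed.

End InducedTrivial.

(** Frobenius reciprocity for a linear character [chi]: the coordinates of an
    eigenvector are determined by the one at the coset [H], which must be zero
    unless [chi] is trivial on [H]; and if it is, [(chi t)^-1] depends only on
    the coset of [t] and gives an eigenvector. *)
Lemma ind_triv_multiplicity (F : decFieldType) (gT : finGroupType)
    (G H : {group gT}) (rS : mx_representation F G 1) :
    ([pchar F]^').-group%g G -> H \subset G ->
  has_multiplicity rS (ind_repr G (triv_repr F H))
    [forall h in H, rS h 0 0 == 1].
Proof.
move=> charG sHG; pose chi (x : gT) : F := rS x 0 0.
have chiM : {in G &, forall x y, chi (x * y)%g = chi x * chi y}.
  move=> x y Gx Gy; rewrite /chi repr_mxM // [rS x]mx11_scalar mul_scalar_mx.
  by rewrite !mxE eqxx mulr1n.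
have chi1 : chi 1%g = 1 by rewrite /chi repr_mx1 mxE eqxx.
have chi0 x : x \in G -> chi x != 0.
  move=> Gx; have := oner_neq0 F; rewrite -chi1 -(mulgV x) chiM ?groupV // mulf_eq0.
  by rewrite negb_or => /andP[].
have CH : (H : {set gT}) \in rcosets H G.
  by apply/rcosetsP; exists 1%g; rewrite ?rcoset1.
pose i0 : 'I_#|rcosets H G| := enum_rank_in CH (H : {set gT}).
have Ei0 : enum_val i0 = H by rewrite enum_rankK_in.
have Gt (j : 'I_#|rcosets H G|) : ind_rep_elt j \in G.
  have /rcosetsP[x Gx Ex] := enum_valP j.
  have : ind_rep_elt j \in enum_val j by rewrite ind_rep_eltP rcoset_refl.
  rewrite Ex => /rcosetP[h Hh ->]; rewrite groupM //; exact: (subsetP sHG).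
have Ei0j (j : 'I_#|rcosets H G|) : (enum_val i0 :* ind_rep_elt j)%g = enum_val j.
  by rewrite Ei0; apply/esym/ind_rep_eltP.
case: (boolP [forall h in H, _]) => [/forall_inP chiH | ].
  pose w : 'rV[F]_(\sum_(i < #|rcosets H G|) 1) :=
    \mxrow_j ((chi (ind_rep_elt j))^-1)%:M.
  have nzw : w != 0.
    apply/eqP => /(congr1 (fun v => submxrow v i0)); rewrite mxrowK submxrow0.
    move/matrixP/(_ 0 0)/eqP; rewrite !mxE eqxx mulr1n invr_eq0.
    by apply/negP/chi0.
  have -> : nat_of_bool true = \rank w.
    by apply/esym/eqP; rewrite eqn_leq rank_leq_row lt0n mxrank_eq0.
  apply: linear_multiplicity => // u.
  split=> [/sub_rVP[a ->]|/ind_triv_fixed fixu].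
    apply/ind_triv_fixed => x i j Gx Eij; rewrite submxrowZ mxrowK.
    rewrite submxrowZ mxrowK scalerA mulrC -scalerA; congr (_ *: _).
    have [h Hh Et] : exists2 h, h \in H & (ind_rep_elt i * x = h * ind_rep_elt j)%g.
      apply/rcosetP; rewrite -ind_rep_eltP -Eij ind_rep_eltP.
      by rewrite mem_rcoset mulgK rcoset_refl.
    have /(congr1 chi) := Et; rewrite !chiM ?Gt // ?(subsetP sHG) //.
    rewrite [chi h](eqP (chiH h Hh)) mul1r => <-.
    rewrite scale_scalar_mx invfM mulrCA divff ?mulr1 ?chi0 //.
  apply/sub_rVP; exists (submxrow u i0 0 0).
  rewrite -[LHS]submxrowK -[RHS]submxrowK; apply/eq_mxrow => j.
  rewrite submxrowZ mxrowK (fixu _ _ _ (Gt j) (Ei0j j)).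
  rewrite scale_scalar_mx [LHS]mx11_scalar; congr (_%:M).
  by rewrite !mxE mulrAC divff ?mul1r // chi0.
rewrite negb_forall_in => /exists_inP[h Hh nchi].
rewrite -[nat_of_bool false](mxrank0 F 1 (\sum_(i < #|rcosets H G|) 1)).
apply: linear_multiplicity => // u.
split=> [/submx0null-> x _|/ind_triv_fixed fixu].
  by rewrite mul0mx scaler0.
have u0 : submxrow u i0 = 0.
  have := fixu h i0 i0 (subsetP sHG h Hh).
  rewrite Ei0 rcoset_id // => /(_ erefl)/eqP.
  rewrite -subr_eq0 -[X in X - _]scale1r -scalerBl scaler_eq0 subr_eq0 eq_sym.
  by rewrite (negPf nchi) => /eqP.
suff -> : u = 0 by rewrite sub0mx.
rewrite -[LHS]submxrowK -[RHS]submxrowK; apply/eq_mxrow => j.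
rewrite submxrow0; apply/eqP; have := fixu _ _ _ (Gt j) (Ei0j j).
rewrite u0 => /esym/eqP; rewrite scaler_eq0 (negPf (chi0 _ (Gt j))) //.
Qed.

(** An irreducible representation with a linear constituent is that
    constituent, so it has degree 1. *)
Lemma linear_constituent_reducible (F : fieldType) (gT : finGroupType)
    (G : {group gT}) n (rG : mx_representation F G n)
    (rS : mx_representation F G 1) k :
  (0 < k)%N -> n != 1%N -> has_multiplicity rS rG k -> ~ mx_irreducible rG.
Proof.
move=> k0 n1 [I [W [J [simW _ _ JP cJ]]]] [_ _ minG].
move: k0; rewrite -cJ => /card_gt0P[i /JP[modW /mxrank_rsim rW]].
have [_ nzW _] := simW i.
have := minG _ modW (submx1 _) nzW => /mxrankS; rewrite mxrank1 rW => nle.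
by have := rank_leq_row (W i); rewrite rW => n0; rewrite eqn_leq nle n0 in n1.
Qed.

(** * The induced representation of a full cycle *)

Theorem theorem5p1 (R : realType) (n : nat) (hn : (1 <= n)%N) (c : 'S_n)
    (hc : cycle_type c = [:: n]) :
  let rho := rho_plus R[i] c in
  [/\ forall g : 'S_n, \tr (rho g) = n`!%:R * ratr `|omega g|,
      repr_degree rho = (n.-1)`!,
      (3 <= n)%N -> ~ mx_irreducible rho,
      has_multiplicity (triv_repr R[i] [set: 'S_n]%G) rho 1 &
      has_multiplicity (sgn_repr R[i] n) rho (if odd n then 1%N else 0%N)].
Proof.
move=> rho; have oc := order_full_cycle hn hc.
have charG : ([pchar R[i]]^').-group%g [set: 'S_n]%G.
  by rewrite /pgroup pcharf'_nat pnatr_eq0 -lt0n cardG_gt0.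
have Edeg : repr_degree rho = (n.-1)`!.
  rewrite /repr_degree sum_nat_const card_ord muln1 -[#|_|]/#|[set: 'S_n] : <[c]>|%g.
  rewrite -divgS ?subsetT // cardsT card_Sn -/(order c) oc.
  by rewrite -{1}(prednK hn) factS prednK // mulKn.
have Mtriv : has_multiplicity (triv_repr R[i] [set: 'S_n]%G) rho 1.
  have := ind_triv_multiplicity (triv_repr R[i] [set: 'S_n]%G) charG (subsetT <[c]>%g).
  by rewrite (introT forall_inP) // => h _; rewrite mxE.
split=> //.
- move=> g; rewrite /omega.
  have /(congr1 (fun x => x / n%:R)) := ind_triv_trace (R[i]) (subsetT <[c]>%g) g.
  have nR0 : n%:R != 0 :> R[i] by rewrite pnatr_eq0 -lt0n.
  rewrite -[#|<[c]>%G|]/(order c) oc mulfK // => ->.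
  have -> : [set x in [set: 'S_n]%G | (g ^ x)%g \in <[c]>%G] =
            [set x | (g ^ x)%g \in <[c]>%g].
    by apply/setP => x; rewrite !inE.
  have cl0 : #|cycle_class n (cycle_type g)|%:R != 0 :> R[i].
    rewrite pnatr_eq0 -lt0n; apply/card_gt0P; exists g; by rewrite inE.
  rewrite normrM normfV normr_nat fmorph_div /= ratr_nat.
  (* Either [g] has cycle type [b^(n/b)] for a divisor [b] of [n], or both sides
     vanish. *)
  case: (boolP (has (fun b => cycle_type g == nseq (n %/ b) b) (divisors n))).
    case/hasP => b; rewrite -dvdn_divisors // => bn /eqP Eg.
    rewrite {1}Eg omega_class_rect // fmorph_div /= !ratr_nat.
    have := card_conj_full_cycle hn hc bn Eg => /(congr1 (fun k => k%:R : R[i])).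
    rewrite !natrM => E; apply: (mulIf cl0).
    rewrite mulrAC E; field.
    by rewrite nR0 cl0.
  move/hasPn => Ng; rewrite (card_conj_full_cycle0 hn hc) ?mul0r => [|b bn E]; last first.
    by have := Ng b; rewrite -dvdn_divisors // E eqxx => /(_ bn).
  have -> : omega_class n (cycle_type g) = 0.
    apply/eqP/negPn/negP => /omega_class_neq0[b bn E].
    by have := Ng b; rewrite -dvdn_divisors // E eqxx => /(_ bn).
  by rewrite normr0 rmorph0 mul0r mulr0.
- move=> n3; apply: linear_constituent_reducible Mtriv => //.
  rewrite -[X in X != _]/(repr_degree rho) Edeg.
  case: (n) n3 => [|[|[|m]]] // _; rewrite gtn_eqF // factS.
  by rewrite (leq_trans _ (leq_pmulr _ (fact_gt0 _))).
have := ind_triv_multiplicity (sgn_repr R[i] n) charG (subsetT <[c]>%g).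
suff -> : [forall h in <[c]>%g, sgn_repr R[i] n h 0 0 == 1] = odd n.
  by case: (odd n).
have oddc := odd_full_cycle hc.
apply/forall_inP/idP => [/(_ c (cycle_id c)) | on h /cycleP[k ->]].
  rewrite mxE eqxx oddc mulr1n; case: (odd n) => //=.
  by rewrite expr1 eqNr oner_eq0.
rewrite on /= in oddc; rewrite mxE eqxx mulr1n.
suff -> : odd_perm (c ^+ k)%g = false by [].
by elim: k => [|k IHk]; rewrite ?odd_perm1 // expgS odd_permM oddc.
Qed.
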